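(* Let $k\ge 2$ and let $(G,\boldsymbol\gamma)$ be a $\mathbb{Z}/k\mathbb{Z}$-colored graph with $m$ edges and lift $(\tilde G,\varphi)$. A generic cone direction network on $(\tilde G,\varphi)$ has a faithful realization that is unique up to scaling if and only if $(G,\boldsymbol\gamma)$ is cone-Laman. That is, there is a proper algebraic subset $Z\subset\mathbb{R}^{2m}$ such that for every direction assignment $\mathbf d\in\mathbb{R}^{2m}\setminus Z$, the cone direction network $(\tilde G,\varphi,\mathbf d)$ has a faithful realization that is unique up to scaling if and only if $(G,\boldsymbol\gamma)$ is cone-Laman.
   Context: Graphs are finite nonempty multigraphs. A $\mathbb{Z}/k\mathbb{Z}$-colored graph $(G,\boldsymbol\gamma)$ is a finite directed graph $G$ with a color $\gamma_{ij}\in\mathbb{Z}/k\mathbb{Z}$ on each edge $ij$. Its lift $(\tilde G,\varphi)$ has vertices $\tilde i_\gamma$ ($i\in V(G)$, $\gamma\in\mathbb{Z}/k\mathbb{Z}$) and, for each edge $ij$ of $G$, the edges $\tilde i_\gamma\tilde j_{\gamma+\gamma_{ij}}$, $\gamma\in\mathbb{Z}/k\mathbb{Z}$; the group $\mathbb{Z}/k\mathbb{Z}$ acts freely by $\varphi(\gamma')\cdot\tilde i_\gamma=\tilde i_{\gamma+\gamma'}$. Let $\mathbb{Z}/k\mathbb{Z}$ act on $\mathbb{R}^2$ with $\gamma$ acting as the rotation $R_k^\gamma$, where $R_k$ is the counter-clockwise rotation about the origin through angle $2\pi/k$. A cone direction network $(\tilde G,\varphi,\mathbf d)$ is a symmetric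 assignment of directions to the edges of $\tilde G$; it is determined by one vector $\mathbf d_{ij}\in\mathbb{R}^2$ per edge $ij\in E(G)$ (so the space of assignments is $\mathbb{R}^{2m}$), where the edge $\tilde i_\gamma\tilde j_{\gamma+\gamma_{ij}}$ gets the direction $R_k^\gamma\mathbf d_{ij}$. A realization is an assignment of points $\mathbf p_v\in\mathbb{R}^2$ to $v\in V(\tilde G)$ with $\langle\mathbf p_w-\mathbf p_v,\mathbf d_{vw}^\perp\rangle=0$ for all edges $vw$ of $\tilde G$ and $\mathbf p_{\varphi(\gamma)\cdot v}=R_k^\gamma\mathbf p_v$ for all $\gamma,v$; here $\perp$ denotes counter-clockwise rotation by $\pi/2$. A realization is faithful if no edge of $\tilde G$ has coincident endpoints. The map $\rho:H_1(G,\mathbb{Z})\to\mathbb{Z}/k\mathbb{Z}$ is the homomorphism defined on oriented cycles by adding up the colors of the traversed edges, with a minus sign for edges traversed in reverse. A subgraph has trivial $\rho$-image if $\rho$ vanishes on all its cycles. $(G,\boldsymbol\gamma)$ with $n$ vertices and $m$ edges is cone-Laman if $m=2n-1$ and every subgraph $G'$ spanned by a nonempty set of edges, with $n'$ vertices, $m'$ edges, $c'$ connected components with non-trivial $\rho$-image and $c_0'$ connected components with trivial $\rho$-image, satisfies $m'\le 2n'-c'-3c_0'$. *)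

(* Defs.v *)
From HB Require Import structures.
From mathcomp Require Import all_boot all_order all_algebra.
From mathcomp Require mpoly.
From mathcomp Require Import all_classical all_reals all_analysis.

Set Implicit Arguments.
Unset Strict Implicit.
Unset Printing Implicit Defensive.

Import Order.TTheory GRing.Theory Num.Theory.

Local Open Scope classical_set_scope.
Local Open Scope ring_scope.

(* Loops and parallel edges are allowed. *)
Record digraph := Digraph {
  vert : finType;
  edge : finType;
  src : edge -> vert;
  tgt : edge -> vert }.

(* 'Z_k is Z/kZ only when 1 < k, which is assumed wherever it matters. *)
Record colored_graph (k : nat) := ColoredGraph {
  cgraph :> digraph;
  color : edge cgraph -> 'Z_k;
  vert_gt0 : (0 < #|vert cgraph|)%N }.

Section Lift.
Variables (k : nat) (G : colored_graph k).

(* The vertex (i, g) is the copy of i labelled g; the edge (e, g) is the copy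
   of e starting at (src e, g). *)
Definition lift : digraph :=
  @Digraph (vert G * 'Z_k)%type (edge G * 'Z_k)%type
    (fun a => (src a.1, a.2))
    (fun a => (tgt a.1, a.2 + color a.1)).

Definition lift_act (g : 'Z_k) (v : vert lift) : vert lift :=
  (v.1, v.2 + g).

End Lift.

Section DirectionNetwork.
Variable R : realType.

Definition rot (t : R) : 'M[R]_2 :=
  \matrix_(i < 2, j < 2)
    if i == j then cos t else if i == 0 then - sin t else sin t.

Definition perp (v : 'cV[R]_2) : 'cV[R]_2 := rot (pi / 2%:R) *m v.

Definition dotv (u v : 'cV[R]_2) : R := \sum_(i < 2) u i 0 * v i 0.

(* R_k ^ g; the exponent is the representative of g in {0, ..., k - 1}, and any
   other one gives the same matrix since R_k ^ k = 1. *)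
Definition rotZ (k : nat) (g : 'Z_k) : 'M[R]_2 := rot (2%:R * pi / k%:R) ^+ g.

Variables (k : nat) (G : colored_graph k).

Definition directions := edge G -> 'cV[R]_2.

Definition lift_dir (d : directions) (a : edge (lift G)) : 'cV[R]_2 :=
  rotZ a.2 *m d a.1.

Definition realization (d : directions) (p : vert (lift G) -> 'cV[R]_2) :=
  (forall a : edge (lift G),
     dotv (p (tgt a) - p (src a)) (perp (lift_dir d a)) = 0) /\
  (forall (g : 'Z_k) (v : vert (lift G)), p (lift_act g v) = rotZ g *m p v).

Definition faithful (p : vert (lift G) -> 'cV[R]_2) :=
  forall a : edge (lift G), p (src a) <> p (tgt a).

Definition unique_faithful_realization (d : directions) :=
  exists p : vert (lift G) -> 'cV[R]_2,
    [/\ realization d p, faithful p &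
        forall q : vert (lift G) -> 'cV[R]_2,
          realization d q -> faithful q ->
          exists2 c : R, c != 0 & forall v, q v = c *: p v].

(* The identification of direction assignments with points of R^(2m). *)
Definition coords (d : directions) : 'I_(#|edge G| * 2) -> R :=
  fun i => mxvec (\matrix_(e < #|edge G|, j < 2) d (enum_val e) j 0) 0 i.

Definition algebraic (Z : set directions) :=
  exists S : set (mpoly.mpoly (#|edge G| * 2) R),
    Z = [set d | forall P, S P -> mpoly.meval (coords d) P = 0].

Definition proper_algebraic (Z : set directions) := algebraic Z /\ Z <> setT.

End DirectionNetwork.

Section Homology.
Variables (k : nat) (G : colored_graph k).
Implicit Types (F : {set edge G}) (z : edge G -> int).

Definition boundary z (v : vert G) : int :=
  \sum_(e | tgt e == v) z e - \sum_(e | src e == v) z e.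

(* H_1 of the subgraph with edge set F: the 1-cycles supported on F. *)
Definition H1 F z :=
  (forall e, e \notin F -> z e = 0) /\ (forall v, boundary z v = 0).

Definition rho z : 'Z_k := \sum_e color e *~ z e.

Definition trivial_rho F := forall z, H1 F z -> rho z = 0.

(* The next definitions and facts check that [rho] on an oriented closed walk
   is the signed sum of the traversed colors. In a walk, (e, true) traverses e
   from src to tgt and (e, false) in reverse. *)
Definition step_src (s : edge G * bool) := if s.2 then src s.1 else tgt s.1.
Definition step_tgt (s : edge G * bool) := if s.2 then tgt s.1 else src s.1.

Fixpoint walk (x : vert G) (w : seq (edge G * bool)) (y : vert G) : bool :=
  if w is s :: w' then (step_src s == x) && walk (step_tgt s) w' y else x == y.

Definition step_sign (s : edge G * bool) : int := if s.2 then 1 else -1.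

Definition walk_chain (w : seq (edge G * bool)) (e : edge G) : int :=
  \sum_(s <- w) (if s.1 == e then step_sign s else 0).

Lemma rho_walk w :
  rho (walk_chain w) = \sum_(s <- w) (if s.2 then color s.1 else - color s.1).
Proof.
rewrite /rho /walk_chain.
under eq_bigr do rewrite mulrz_sumr.
rewrite exchange_big /=; apply: eq_bigr => -[e b] _ /=.
rewrite (bigD1 e) //= eqxx big1 ?addr0 => [|e' /negPf ne]; last first.
  by rewrite eq_sym ne mulr0z.
by case: b; rewrite /step_sign /= ?mulrN1z.
Qed.

Lemma boundary_walk x w y : walk x w y ->
  forall v, boundary (walk_chain w) v = (v == y)%:Z - (v == x)%:Z.
Proof.
have sumD (P : pred (edge G)) e c :
    \sum_(e' | P e') (if e == e' then c else 0 : int) = if P e then c else 0.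
  case: ifP => Pe; last by apply: big1 => e' Pe'; case: eqP Pe' => // <-; rewrite Pe.
  rewrite (bigD1 e) //= eqxx big1 ?addr0 // => e' /andP[_ /negPf ne].
  by rewrite eq_sym ne.
elim: w x => [|[e b] w IHw] x /=.
  move=> /eqP <- v; rewrite /boundary /walk_chain subrr.
  by rewrite !big1 ?subrr // => e _; rewrite big_nil.
case/andP=> /eqP <- /IHw {}IHw v.
have -> : boundary (walk_chain ((e, b) :: w)) v =
    boundary (walk_chain w) v + ((v == step_tgt (e, b))%:Z - (v == step_src (e, b))%:Z).
  rewrite /boundary /walk_chain.
  under eq_bigr do rewrite big_cons.
  under [X in _ - X]eq_bigr do rewrite big_cons.
  rewrite !big_split /= (sumD (fun e => tgt e == v)) (sumD (fun e => src e == v)).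
  rewrite opprD addrACA [RHS]addrC; congr (_ + _).
  rewrite /step_sign /step_src /step_tgt /= !(eq_sym v).
  by case: b {IHw}; case: eqP; case: eqP.
by rewrite IHw addrA subrK.
Qed.

End Homology.

Section ConeLaman.
Variables (k : nat) (G : colored_graph k).
Implicit Types F : {set edge G}.

Definition span_vert F : {set vert G} :=
  ([set src e | e in F] :|: [set tgt e | e in F])%SET.

Definition adj F : rel (vert G) := fun u v =>
  [exists e in F, ((src e == u) && (tgt e == v)) || ((src e == v) && (tgt e == u))].

Definition components F : {set {set vert G}} :=
  equivalence_partition (connect (adj F)) (span_vert F).

Definition component_edges F (C : {set vert G}) : {set edge G} :=
  [set e in F | src e \in C]%SET.

Definition num_nontrivial F : nat :=
  #|[set C in components F | ~~ `[< trivial_rho (component_edges F C) >]]%SET|.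

Definition num_trivial F : nat :=
  #|[set C in components F | `[< trivial_rho (component_edges F C) >]]%SET|.

Definition cone_laman :=
  #|edge G|%:Z = 2 * #|vert G|%:Z - 1 /\
  forall F, F <> finset.set0 ->
    #|F|%:Z <= 2 * #|span_vert F|%:Z - (num_nontrivial F)%:Z
               - 3 * (num_trivial F)%:Z.

End ConeLaman.

(* Main.v *)
Require Import Defs.
From mathcomp Require Import all_boot all_order all_algebra.
From mathcomp Require mpoly.
From mathcomp Require Import all_classical all_reals all_analysis.
From mathcomp Require Import zify ring lra.
From mathcomp Require Import fintype finset.
Import -(notations) mathcomp.multinomials.mpoly.

(* A realization is determined by the points x_i of the vertices (i, 0), and an
   edge e = ij imposes <d_e, A_e x> = 0, where A_e x is R_k^(color e) x_j - x_i
   up to a quarter turn. Let r(F) be the dimension of the span of the rows of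
   all A_e, e in F; computing the kernel componentwise gives
   r(F) = 2 n' - 2 c_0', so cone-Laman means that m = 2n - 1 and |F| < r(F) for
   every nonempty F.
   By Rado's theorem one row can be chosen from each A_e, e in F, so that these
   are independent if and only if |S| <= r(S) for all S included in F; the same
   is then true of generic d. If |F| < r(F) for all F, doubling any edge e keeps
   this condition, so for generic d the only solution with A_e x = 0 is x = 0,
   and the solutions form a line of faithful realizations. Conversely, on a
   minimal F with |F| >= r(F) the generic equations already force A_e x = 0 for
   every e in F, so that no realization is faithful. *)

Set Implicit Arguments.
Unset Strict Implicit.
Unset Printing Implicit Defensive.

Import Order.TTheory GRing.Theory Num.Theory.

Local Open Scope ring_scope.

Local Notation rot := Defs.rot.

(** * Row spaces and Rado's theorem *)

Section RowSpaces.
Variables (K : fieldType) (N : nat).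

Lemma sub_mulmx_eq0 m1 m2 (A : 'M[K]_(m1, N)) (B : 'M[K]_(m2, N)) (x : 'cV[K]_N) :
  (A <= B)%MS -> B *m x = 0 -> A *m x = 0.
Proof. by case/submxP=> D -> Bx; rewrite -mulmxA Bx mulmx0. Qed.

Lemma full_rank_kernel m (A : 'M[K]_(m, N)) :
  (forall x : 'cV[K]_N, A *m x = 0 -> x = 0) -> \rank A = N.
Proof.
move=> kerA; rewrite -mxrank_tr; apply/eqP; apply: inj_row_free => v vA.
apply: trmx_inj; rewrite trmx0; apply: kerA; apply: trmx_inj.
by rewrite trmx_mul trmxK vA trmx0.
Qed.

Lemma full_rank_mulmx_eq0 m (A : 'M[K]_(m, N)) (x : 'cV[K]_N) :
  (N <= \rank A)%N -> A *m x = 0 -> x = 0.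
Proof.
move=> rA Ax; rewrite -[x]mul1mx; apply: sub_mulmx_eq0 Ax.
by apply: submx_full; rewrite /row_full eqn_leq rank_leq_col.
Qed.

(** The kernel has dimension [N - \rank A], which exceeds [\rank X]. With [X] the row of a known
    solution this yields a second, independent one. *)
Lemma kernel_not_sub m p (A : 'M[K]_(m, N)) (X : 'M[K]_(p, N)) :
  (\rank A + \rank X < N)%N ->
  exists2 y : 'cV[K]_N, A *m y = 0 & ~~ (y^T <= X)%MS.
Proof.
move=> rAX.
have [/forallP sub|/forallPn[i nsub]] :=
    boolP [forall i, (row i (kermx A^T) <= X)%MS].
  have /mxrankS : (kermx A^T <= X)%MS by apply/row_subP.
  by rewrite mxrank_ker mxrank_tr leq_subLR leqNgt rAX.
exists (row i (kermx A^T))^T; last by rewrite trmxK.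
apply: trmx_inj; rewrite trmx_mul trmxK trmx0; apply/eqP.
by rewrite -sub_kermx row_sub.
Qed.

(** [<<_>>] makes every block square, so that blocks of any height are summed as subspaces. *)
Definition rowspan (I : finType) m (S : {set I}) (A : I -> 'M[K]_(m, N)) : 'M[K]_N :=
  (\sum_(i in S) <<A i>>)%MS.

Section Rowspan.
Variable I : finType.
Implicit Types S T : {set I}.

Lemma rowspan_sub m p S (A : I -> 'M[K]_(m, N)) (B : 'M[K]_(p, N)) :
  (forall i, i \in S -> (A i <= B)%MS) -> (rowspan S A <= B)%MS.
Proof. by move=> AB; apply/sumsmx_subP => i iS; rewrite genmxE AB. Qed.

Lemma sub_rowspan m S (A : I -> 'M[K]_(m, N)) i :
  i \in S -> (A i <= rowspan S A)%MS.
Proof. by move=> iS; apply: (sumsmx_sup i); rewrite ?genmxE. Qed.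

Lemma rowspanS m S T (A : I -> 'M[K]_(m, N)) :
  S \subset T -> (rowspan S A <= rowspan T A)%MS.
Proof.
by move=> ST; apply: rowspan_sub => i iS; apply: sub_rowspan; apply: (subsetP ST).
Qed.

Lemma rowspan_mulmx_eq0 m S (A : I -> 'M[K]_(m, N)) (x : 'cV[K]_N) :
  (forall i, i \in S -> A i *m x = 0) -> rowspan S A *m x = 0.
Proof.
move=> Ax; apply/eqP; rewrite -sub_kermx; apply: rowspan_sub => i iS.
by rewrite sub_kermx Ax.
Qed.

Lemma mxrank_rowspan m S (A : I -> 'M[K]_(m, N)) :
  (\rank (rowspan S A) <= m * #|S|)%N.
Proof.
rewrite -sum1_card big_distrr /= muln1 /rowspan.
elim/big_rec2: _ => [|i r B _ le]; first by rewrite mxrank0.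
by apply: leq_trans (mxrank_adds_leqif _ _) _; rewrite leq_add // genmxE rank_leq_row.
Qed.

End Rowspan.

Section Rado.
Variables (I : finType) (F : {set I}).

(** Rado's condition; when the rows of each [B i] are unit vectors it is Hall's marriage
    condition. *)
Definition hall m (B : I -> 'M[K]_(m, N)) :=
  forall S : {set I}, S \subset F -> (#|S| <= \rank (rowspan S B))%N.

Lemma hallPn m (B : I -> 'M[K]_(m, N)) :
  hall B \/ exists2 S : {set I}, S \subset F & (\rank (rowspan S B) < #|S|)%N.
Proof.
have [/forallP h|/forallPn[S]] := boolP [forall S : {set I}, (S \subset F) ==>
    (#|S| <= \rank (rowspan S B))%N].
  by left=> S SF; move/implyP: (h S); apply.
by rewrite negb_imply -ltnNge => /andP[SF lt]; right; exists S.
Qed.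

(* If both replacements violated the rank condition, on j |: S and j |: T say,
   submodularity of the rank would make j |: (S :|: T) or S :&: T violate it
   for B. *)
Lemma hall_split m (B : I -> 'M[K]_(m, N)) (j : I) (C D : 'M[K]_(m, N)) :
  hall B -> (B j <= C + D)%MS ->
  hall (fun i => if i == j then C else B i) \/
  hall (fun i => if i == j then D else B i).
Proof.
move=> hB BCD.
have viol (X : 'M[K]_(m, N)) : hall (fun i => if i == j then X else B i) \/
   exists S : {set I}, [/\ S \subset F, j \in F, j \notin S &
     (\rank (rowspan S B + X)%MS <= #|S|)%N].
  case: (hallPn (fun i => if i == j then X else B i)) => [|[S SF lt]]; first by left.
  (* If [j] lies outside [S], the replacement is invisible on [S] and [hB] excludes the
     violation. *)
  right; have [jS|jS] := boolP (j \in S); last first.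
    have := hB _ SF; rewrite leqNgt; case/negP; apply: leq_ltn_trans lt.
    apply/mxrankS/rowspan_sub => i iS.
    have := sub_rowspan (fun i => if i == j then X else B i) iS.
    by case: eqP iS jS => // -> ->.
  rewrite (cardsD1 j) jS add1n ltnS in lt; exists (S :\ j); split=> //.
  - by apply: subset_trans SF; apply: subD1set.
  - exact: (subsetP SF).
  - by rewrite !inE eqxx.
  apply: leq_trans lt; apply: mxrankS; rewrite addsmx_sub; apply/andP; split.
    apply: rowspan_sub => i; rewrite !inE => /andP[/negPf ij iS].
    by have := sub_rowspan (fun i => if i == j then X else B i) iS; rewrite ij.
  by have := sub_rowspan (fun i => if i == j then X else B i) jS; rewrite eqxx.
have [|[S [SF jF jS rS]]] := viol C; first by left.
have [|[T [TF _ jT rT]]] := viol D; first by right.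
exfalso; move: (leq_add rS rT); rewrite -mxrank_sum_cap -cardsUI; apply/negP.
rewrite -ltnNge -addSn; apply: leq_add.
  have -> : (#|S :|: T|.+1 = #|j |: (S :|: T)|)%N.
    by rewrite cardsU1 !inE (negPf jS) (negPf jT).
  apply: leq_trans (hB _ _) _; first by rewrite !subUset sub1set jF SF.
  apply: mxrankS; apply: rowspan_sub => i; rewrite !inE.
  case/orP=> [/eqP->|/orP[iS|iT]].
  - by apply: submx_trans BCD _; rewrite addsmxS // addsmxSr.
  - apply: submx_trans (addsmxSl _ _); apply: submx_trans (addsmxSl _ _).
    exact: sub_rowspan.
  apply: submx_trans (addsmxSr _ _); apply: submx_trans (addsmxSl _ _).
  exact: sub_rowspan.
apply: leq_trans (hB (S :&: T) _) _; first by apply: subset_trans SF; apply: subsetIl.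
apply: mxrankS; rewrite sub_capmx.
by apply/andP; split; apply: submx_trans (addsmxSl _ _); apply: rowspanS;
  [apply: subsetIl | apply: subsetIr].
Qed.

(* Rado's theorem on independent transversals, for planes in a vector space. *)
Lemma rado_planes (A : I -> 'M[K]_(2, N)) :
  hall A ->
  exists w : I -> 'rV[K]_2, (#|F| <= \rank (rowspan F (fun i => w i *m A i)))%N.
Proof.
move=> hA.
(* The planes are cut down to single rows one index at a time along [enum F], with Rado's condition
   as invariant. *)
have [w hw] : exists w : I -> 'rV[K]_2,
    hall (fun i => if i \in enum F then <<w i *m A i>> else <<A i>>)%MS.
  elim: (enum F) => [|j s [w hw]].
    exists (fun=> 0) => S SF; apply: leq_trans (hA _ SF) _; apply: mxrankS.
    apply: rowspan_sub => i iS.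
    by have := sub_rowspan (fun i => <<A i>>%MS) iS; rewrite genmxE.
  have [js|js] := boolP (j \in s).
    exists w => S SF; apply: leq_trans (hw _ SF) _; apply: mxrankS.
    apply: rowspan_sub => i iS.
    have := sub_rowspan
      (fun i => if i \in j :: s then <<w i *m A i>>%MS else <<A i>>%MS) iS.
    by rewrite inE; case: eqP => // ->; rewrite js.
  (* A plane is the sum of the lines of its two rows, so [hall_split] keeps the condition for one of
     them, selected by the unit vector [delta_mx 0 a]. *)
  have rows : (<<A j>> <= <<row 0 (A j)>> + <<row 1 (A j)>>)%MS.
    rewrite genmxE; apply/row_subP => a.
    have [->|->] : a = 0 \/ a = 1.
      by case: a => -[|[|//]] p; [left | right]; apply: val_inj.
    by apply: submx_trans (addsmxSl _ _); rewrite genmxE.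
    by apply: submx_trans (addsmxSr _ _); rewrite genmxE.
  have fin a : hall (fun i => if i == j then <<row a (A j)>>%MS else
      if i \in s then <<w i *m A i>>%MS else <<A i>>%MS) ->
      exists w : I -> 'rV[K]_2,
        hall (fun i => if i \in j :: s then <<w i *m A i>> else <<A i>>)%MS.
    move=> h; pose w' i := if i == j then delta_mx 0 a else w i.
    exists w' => S SF.
    apply: leq_trans (h _ SF) _; apply: mxrankS; apply: rowspan_sub => i iS.
    have := sub_rowspan
      (fun i => if i \in j :: s then <<w' i *m A i>>%MS else <<A i>>%MS) iS.
    by rewrite /w' inE; case: eqP => //= ->; rewrite -rowE.
  have := hall_split (j := j) hw; rewrite (negPf js) => /(_ _ _ rows).
  by case=> /fin.
exists w; apply: leq_trans (hw F _) _ => //; apply: mxrankS.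
apply: rowspan_sub => i iF; rewrite mem_enum iF genmxE.
exact: (sub_rowspan (fun i => w i *m A i)).
Qed.

End Rado.

(** * Systems with one linear equation per plane *)

Section PlaneSystem.
Variables (E : finType) (A : E -> 'M[K]_(2, N)).

Definition sparse :=
  forall F : {set E}, F != set0 -> (#|F| < \rank (rowspan F A))%N.

Definition solution (w : E -> 'rV[K]_2) (x : 'cV[K]_N) :=
  forall e, w e *m A e *m x = 0.

Definition noncollapsed (x : 'cV[K]_N) := forall e, A e *m x <> 0.

Definition unique_noncollapsed (w : E -> 'rV[K]_2) :=
  exists x, [/\ solution w x, noncollapsed x &
    forall y, solution w y -> noncollapsed y -> exists2 c, c != 0 & y = c *: x].

(* A minimal violation F of sparsity satisfies Rado's condition, so its rows
   span the whole space rowspan F A, and every solution is degenerate on F. *)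
Lemma noncollapsed_sparse (w : E -> 'rV[K]_2) (x : 'cV[K]_N) :
  (forall F, hall F A -> #|F| <= \rank (rowspan F (fun e => w e *m A e)))%N ->
  solution w x -> noncollapsed x -> sparse.
Proof.
move=> generic wx ndx F; have [n] := ubnP #|F|; elim: n F => // n IH F.
rewrite ltnS => Fn F0; rewrite ltnNge; apply/negP => tight.
case/set0Pn: (F0) => e0 e0F.
have proper_sparse (S : {set E}) : S \proper F -> S != set0 ->
    (#|S| < \rank (rowspan S A))%N.
  by move=> SF; apply: IH; apply: leq_trans (proper_card SF) Fn.
have span : (rowspan F (fun e => w e *m A e) <= rowspan F A)%MS.
  apply: rowspan_sub => e eF; apply: submx_trans (submxMl _ _) _.
  exact: sub_rowspan.
have r0 : (0 < \rank (rowspan F A))%N.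
  rewrite lt0n mxrank_eq0; apply/eqP => z; apply: (ndx e0).
  by apply: sub_mulmx_eq0 (sub_rowspan A e0F) _; rewrite z mul0mx.
have hallF : hall F A.
  move=> S SF; have [->|S0] := eqVneq S set0; first by rewrite cards0.
  have [EF|SnF] := eqVneq S F; last first.
    by apply: ltnW; apply: proper_sparse => //; rewrite properEneq SnF.
  (* For [F] itself, the rank over [F :\ e0] already exceeds [#|F| - 1]; if [F :\ e0] is empty, [r0]
     suffices. *)
  rewrite {}EF {S SF S0}; rewrite (cardsD1 e0) e0F add1n.
  have [->|D0] := eqVneq (F :\ e0) set0; first by rewrite cards0.
  apply: leq_trans (proper_sparse _ (properD1 e0F) D0) _.
  exact/mxrankS/rowspanS/subD1set.
have eqspan : (rowspan F A <= rowspan F (fun e => w e *m A e))%MS.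
  rewrite -(geq_leqif (mxrank_leqif_sup span)).
  exact: leq_trans tight (generic _ hallF).
apply: (ndx e0); apply: sub_mulmx_eq0 (sub_rowspan A e0F) _.
apply: sub_mulmx_eq0 eqspan _.
by apply: rowspan_mulmx_eq0 => e _; apply: wx.
Qed.

(** If [N] exceeded [#|E| + 1], some solution [y] would be independent of [x]. Each edge collapses
    in [x + t y] for at most one [t], so some nonzero [t] gives a noncollapsed solution that is not
    a multiple of [x]. *)
Lemma unique_noncollapsed_card (w : E -> 'rV[K]_2) :
  (forall n, n.+1%:R != 0 :> K) -> unique_noncollapsed w -> (N <= #|E| + 1)%N.
Proof.
move=> char0 [x [wx ndx uniq]]; rewrite leqNgt; apply/negP => lt.
have [|y ky nxy] :=
    @kernel_not_sub _ _ (rowspan [set: E] (fun e => w e *m A e)) x^T.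
  apply: leq_ltn_trans lt; apply: leq_add (rank_leq_row _).
  by rewrite -cardsT -[X in (_ <= X)%N]mul1n mxrank_rowspan.
have wy : solution w y.
  by move=> e; apply: sub_mulmx_eq0 ky; apply: sub_rowspan (in_setT e).
(* One value more than there are edges, starting at 1 so that [t i] can be inverted at the end. *)
pose t (i : 'I_(#|E|.+1)) : K := i.+1%:R.
have t_inj : injective t.
  have wlg (i j : 'I_(#|E|.+1)) : t i = t j -> (i <= j)%N.
    rewrite leqNgt => tij; apply/negP => ji; move/eqP: tij.
    rewrite /t -subr_eq0 -natrB 1?ltnS 1?ltnW // subSS.
    by move: ji; rewrite -subn_gt0; case: (_ - _)%N => // n _; apply/negP.
  by move=> i j tij; apply/val_inj/eqP; rewrite eqn_leq !wlg.
have [i ndt] : exists i, noncollapsed (x + t i *: y).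
  have [/existsP[i /forallP h]|/existsPn h] :=
      boolP [exists i, forall e, A e *m (x + t i *: y) != 0].
    by exists i => e; apply/eqP.
  have deg i : {e | A e *m (x + t i *: y) == 0}.
    by apply: sigW; have /forallPn[e] := h i; rewrite negbK; exists e.
  (* An edge collapsing for two values of [t] would collapse for [y], by subtraction, and then for
     [x]. *)
  have f_inj : injective (fun i => sval (deg i)).
    move=> i j /=; have /eqP := svalP (deg i); have /eqP := svalP (deg j).
    move=> + + ee; rewrite -{}ee; set e := sval _ => ej ei.
    apply: t_inj; apply/eqP; rewrite -subr_eq0.
    apply/negPn/negP => nz; apply: (ndx e).
    have := congr2 (fun a b => a - b) ei ej; rewrite subr0 -mulmxBr opprD addrACA.
    rewrite subrr add0r -scalerBl -scalemxAr => /eqP; rewrite scaler_eq0.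
    case/orP=> [z|/eqP z]; first by rewrite z in nz.
    by move: ei; rewrite mulmxDr -scalemxAr z scaler0 addr0.
  by have := leq_card _ f_inj; rewrite card_ord ltnn.
have [|c _ /eqP] := uniq (x + t i *: y) _ ndt.
  by move=> e; rewrite mulmxDr -scalemxAr wx wy scaler0 addr0.
rewrite addrC eq_sym -subr_eq -{2}[x]scale1r -scalerBl => /eqP E1.
case/negP: nxy; rewrite -[y]scale1r -(mulVf (char0 i)) -scalerA -/(t i) -E1.
by rewrite !linearZ /= !scalemx_sub.
Qed.

(** The extra equation at [e] holds wherever [A e] collapses, so a nonzero solution collapses no
    edge. At one fixed edge it is an injective linear functional on the solutions, which therefore
    form a line. *)
Lemma sparse_unique_noncollapsed (w : E -> 'rV[K]_2) :
  (1 < N)%N -> (#|E| + 1 = N)%N ->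
  (forall e, exists w' : 'rV[K]_2, forall x : 'cV[K]_N,
     solution w x -> w' *m A e *m x = 0 -> x = 0) ->
  unique_noncollapsed w.
Proof.
move=> N1 EN rigid.
have /card_gt0P[e0 _] : (0 < #|E|)%N by rewrite -EN addn1 ltnS in N1.
have ndeg x : solution w x -> x != 0 -> noncollapsed x.
  move=> wx x0 e Ax; have [w' /(_ x wx)] := rigid e.
  by rewrite -mulmxA Ax mulmx0 => /(_ erefl) /eqP; rewrite (negPf x0).
have [x wx x0] : exists2 x, solution w x & x != 0.
  have [|x kx nx] :=
      @kernel_not_sub _ _ (rowspan [set: E] (fun e => w e *m A e)) (0 : 'rV_N).
    rewrite mxrank0 addn0; apply: leq_ltn_trans (mxrank_rowspan _ _) _.
    by rewrite cardsT mul1n -[X in (_ < X)%N]EN addn1.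
  exists x; last by apply: contraNneq nx => ->; rewrite trmx0 sub0mx.
  by move=> e; apply: sub_mulmx_eq0 kx; apply: sub_rowspan (in_setT e).
exists x; split=> // [|y wy ndy]; first exact: ndeg.
have [w' uw'] := rigid e0.
have eqc (u : 'cV[K]_N) : w' *m A e0 *m u = (w' *m A e0 *m u) 0 0 *: 1%:M.
  by apply/matrixP => i j; rewrite !ord1 !mxE eqxx mulr1.
have nz z : solution w z -> z != 0 -> (w' *m A e0 *m z) 0 0 != 0.
  move=> wz; apply: contra_neq => h; apply: uw' => //.
  by rewrite eqc h scale0r.
have y0 : y != 0.
  by apply/eqP => yz; apply: (ndy e0); rewrite yz mulmx0.
(* [y - (b / a) x] satisfies the extra equation at [e0], so it vanishes. *)
pose a := (w' *m A e0 *m x) 0 0; pose b := (w' *m A e0 *m y) 0 0.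
have a0 : a != 0 by apply: nz.
exists (b / a); first by rewrite mulf_neq0 ?invr_eq0 // nz.
apply/eqP; rewrite -subr_eq0; apply/eqP; apply: uw' => [e|].
  by rewrite mulmxBr -scalemxAr wx wy scaler0 subr0.
rewrite mulmxBr -scalemxAr eqc [X in _ - _ *: X]eqc -/a -/b scalerA -scalerBl.
by rewrite mulfVK // subrr scale0r.
Qed.

(** [None] is a second copy of [e0]; identifying the copies lowers [#|S|] by at most one, which the
    strict inequality absorbs. *)
Lemma sparse_hall_double (e0 : E) :
  sparse -> hall [set: option E] (fun o => A (odflt e0 o)).
Proof.
move=> sp S _; have [->|S0] := eqVneq S set0; first by rewrite cards0.
have leS : (#|S| <= #|odflt e0 @: S|.+1)%N.
  apply: leq_trans (_ : #|None |: (Some @: (odflt e0 @: S))| <= _)%N.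
    apply: subset_leq_card; apply/subsetP => -[e|] eS; rewrite !inE //=.
    by rewrite (mem_imset _ _ (@Some_inj _)) (imset_f (odflt e0) eS).
  rewrite cardsU1 -add1n leq_add ?leq_b1 //.
  exact: leq_imset_card.
apply: leq_trans leS _; apply: leq_trans (sp _ _) _.
  by case/set0Pn: S0 => o oS; apply/set0Pn; exists (odflt e0 o); apply: imset_f.
apply/mxrankS/rowspan_sub => e /imsetP[x xS ->].
exact: (sub_rowspan (fun o => A (odflt e0 o))).
Qed.

End PlaneSystem.
End RowSpaces.

(** * Generic systems *)

Section Generic.
Variable K : numFieldType.

(** * Nonvanishing polynomials and generic rank *)

Section Polynomials.
Variable n : nat.
Implicit Types (P Q : mpoly n K) (u v : 'I_n -> K).

(** The line meets [u] at [t = 0] and [v] at [t = 1]; along it nonvanishing becomes a question in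
    one variable. *)
Lemma meval_line P u v : exists q : {poly K},
  forall t, q.[t] = meval (fun i => u i + t * (v i - u i)) P.
Proof.
elim/mpolyind: P => [|c m P _ _ [q qE]]; first by exists 0 => t; rewrite horner0 meval0.
exists (c *: \prod_(i < n) ((u i)%:P + (v i - u i) *: 'X) ^+ m i + q) => t.
rewrite hornerD hornerZ horner_prod mevalD mevalZ mevalX qE; congr (_ * _ + _).
by apply: eq_bigr => i _; rewrite horner_exp hornerD hornerC hornerZ hornerX mulrC.
Qed.

(** In characteristic zero the naturals below [size q] are distinct, and [q] has fewer than [size q]
    roots. *)
Lemma poly_nonroot (q : {poly K}) : q != 0 -> exists t, q.[t] != 0.
Proof.
move=> q0; pose rs := [seq i%:R : K | i <- iota 0 (size q)].
have [/allP roots|/allPn[t _ nt]] := boolP (all (root q) rs); last by exists t.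
have := max_poly_roots q0 (introT allP roots); rewrite size_map size_iota ltnn.
by case/(_ _)/notF;
  rewrite map_inj_uniq ?iota_uniq // => i j /eqP; rewrite eqr_nat => /eqP.
Qed.

Definition nonvanishing P := exists v, meval v P != 0.

(** Both factors restrict to nonzero polynomials on the line through the two witnesses. *)
Lemma nonvanishingM P Q : nonvanishing P -> nonvanishing Q -> nonvanishing (P * Q).
Proof.
move=> [u Pu] [v Qv]; have [p pE] := meval_line P u v; have [q qE] := meval_line Q u v.
have [|t] := @poly_nonroot (p * q).
  apply: mulf_neq0.
    apply: contra_neq Pu => p0; have := pE 0; rewrite p0 horner0 => ->.
    by apply: meval_eq => i; rewrite mul0r addr0.
  apply: contra_neq Qv => q0; have := qE 1; rewrite q0 horner0 => ->.
  by apply: meval_eq => i; rewrite mul1r addrC subrK.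
by rewrite hornerM pE qE -mevalM => ?; eexists; eassumption.
Qed.

Lemma nonvanishing_prod (I : finType) (P : I -> mpoly n K) :
  (forall i, nonvanishing (P i)) -> nonvanishing (\prod_i P i).
Proof.
move=> nP; elim/big_rec: _ => [|i Q _]; last exact: nonvanishingM.
by exists (fun=> 0); rewrite meval1 oner_eq0.
Qed.

Lemma map_mx_mevalC v m p (A : 'M[K]_(m, p)) :
  map_mx (meval v) (map_mx (@mpolyC n K) A) = A.
Proof. by apply/matrixP => i j; rewrite !mxE mevalC. Qed.

(** [L] and [Q] invert the rank factorization of [M] at [u], so the determinant [P] of [L *m M *m Q]
    is 1 at [u]; where it is nonzero the rank is at least [r]. *)
Lemma generic_rank m N (M : 'M[mpoly n K]_(m, N)) u :
  exists2 P, meval u P != 0 & forall v, meval v P != 0 ->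
    (\rank (map_mx (meval u) M) <= \rank (map_mx (meval v) M))%N.
Proof.
set Mu := map_mx _ M; set r := \rank Mu.
pose L := pinvmx (col_base Mu); pose Q := pinvmx (row_base Mu).
pose P := \det (map_mx (@mpolyC n K) L *m M *m map_mx (@mpolyC n K) Q).
have PE v : meval v P = \det (L *m map_mx (meval v) M *m Q).
  by rewrite -det_map_mx !map_mxM !map_mx_mevalC.
exists P => [|v]; rewrite PE.
  have LMu : L *m Mu = row_base Mu.
    by rewrite -[X in L *m X]mulmx_base mulmxA mulVpmx ?col_base_full // mul1mx.
  by rewrite -/Mu LMu mulmxVp ?row_base_free // det1 oner_eq0.
rewrite -unitfE -unitmxE => /mxrank_unit rk.
apply: leq_trans (eq_leq (esym rk)) _.
by apply: leq_trans (mxrankM_maxl _ _) _; apply: mxrankM_maxr.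
Qed.

Lemma generic_rowspan N (I : finType) (F : {set I}) (B : I -> 'rV[mpoly n K]_N) u :
  exists2 P, meval u P != 0 & forall v, meval v P != 0 ->
    (\rank (rowspan F (fun i => map_mx (meval u) (B i))) <=
     \rank (rowspan F (fun i => map_mx (meval v) (B i))))%N.
Proof.
(* Stacked with zero rows outside [F], the [B i] form one matrix whose row space is their span over
   [F]. *)
pose M := \matrix_(i < #|I|) if enum_val i \in F then B (enum_val i) else 0.
have rowM v i : row i (map_mx (meval v) M) =
    if enum_val i \in F then map_mx (meval v) (B (enum_val i)) else 0.
  by rewrite -map_row rowK; case: ifP => // _; rewrite map_mx0.
have rankM v : \rank (rowspan F (fun i => map_mx (meval v) (B i))) =
    \rank (map_mx (meval v) M).
  apply/eqP; rewrite eqn_leq; apply/andP; split; apply: mxrankS.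
    apply: rowspan_sub => i iF; have := rowM v (enum_rank i).
    by rewrite enum_rankK iF => <-; apply: row_sub.
  apply/row_subP => i; rewrite rowM; case: ifP => [iF|_]; last exact: sub0mx.
  exact: (sub_rowspan (fun i => map_mx (meval v) (B i))).
have [P Pu PM] := generic_rank M u; exists P => // v /PM.
by rewrite !rankM.
Qed.

End Polynomials.

(** * Plane systems with generic coefficient vectors *)

Section GenericSystem.
Variables (E : finType) (N : nat) (A : E -> 'M[K]_(2, N)).

Let n := (#|E| * 2)%N.
(** The coordinates are ordered by [mxvec], as in [coords]. *)
Let varE (e : E) (j : 'I_2) : 'I_n := mxvec_index (enum_rank e) j.

Definition edge_vector (v : 'I_n -> K) (e : E) : 'rV[K]_2 := \row_j v (varE e j).

(** The row of [e] with indeterminate coefficients; every choice of vectors is a specialization. *)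
Let symb (e : E) : 'rV[mpoly n K]_N :=
  (\row_j mpolyX K (mnm1 (varE e j))) *m map_mx (@mpolyC n K) (A e).

Let symbE v e : map_mx (meval v) (symb e) = edge_vector v e *m A e.
Proof.
rewrite /symb map_mxM map_mx_mevalC; congr (_ *m _).
by apply/rowP => j; rewrite !mxE /= mevalXU.
Qed.

Lemma edge_vector_surj (w : E -> 'rV[K]_2) : exists v, edge_vector v =1 w.
Proof.
exists (mxvec (\matrix_(i < #|E|, j < 2) w (enum_val i) 0 j) 0) => e.
by apply/rowP => j; rewrite mxE mxvecE mxE enum_rankK.
Qed.

(** Rado's theorem gives one point where the rows over [F] are independent, and the rank drops only
    on the zero set of [P]. If [hall F A] fails, the claim is vacuous and [P = 1] serves. *)
Lemma generic_independent (F : {set E}) : exists2 P, nonvanishing P &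
  forall v, meval v P != 0 -> hall F A ->
    (#|F| <= \rank (rowspan F (fun e => edge_vector v e *m A e)))%N.
Proof.
have [h|[S SF lt]] := hallPn F A; last first.
  exists 1; first by exists (fun=> 0); rewrite meval1 oner_eq0.
  by move=> v _ /(_ S SF); rewrite leqNgt lt.
have [w rw] := rado_planes h; have [u uw] := edge_vector_surj w.
have [P Pu Pv] := generic_rowspan F symb u; exists P; first by exists u.
move=> v /Pv le _; apply: leq_trans rw _.
apply: leq_trans (leq_trans le _).
  apply/mxrankS/rowspan_sub => e eF; rewrite -uw -symbE.
  exact: (sub_rowspan (fun e => map_mx _ (symb e))).
apply: mxrankS; apply: rowspan_sub => e eF; rewrite symbE.
exact: (sub_rowspan (fun e => edge_vector v e *m A e)).
Qed.

(** With [e0] doubled, Rado's theorem gives [#|E| + 1] independent rows at one point, hence wherever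
    [P] is nonzero; when this number is [N], only the zero solution remains. *)
Lemma generic_rigid (e0 : E) : exists2 P, nonvanishing P &
  forall v, meval v P != 0 -> (#|E| + 1 = N)%N -> sparse A ->
    exists w' : 'rV[K]_2, forall x : 'cV[K]_N,
      solution A (edge_vector v) x -> w' *m A e0 *m x = 0 -> x = 0.
Proof.
have [h|[S SF lt]] := hallPn [set: option E] (fun o => A (odflt e0 o)); last first.
  exists 1; first by exists (fun=> 0); rewrite meval1 oner_eq0.
  by move=> v _ _ sp; have := sparse_hall_double e0 sp SF; rewrite leqNgt lt.
have [w rw] := rado_planes h.
have [u uw] := edge_vector_surj (fun e => w (Some e)).
(* The row of the second copy is constant, so that the same [w'] serves every [v]. *)
pose B o := if o is Some e then symb e else map_mx (@mpolyC n K) (w None *m A e0).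
have BE v o : map_mx (meval v) (B o) =
    if o is Some e then edge_vector v e *m A e else w None *m A e0.
  by case: o => [e|] /=; [apply: symbE | apply: map_mx_mevalC].
have [P Pu Pv] := generic_rowspan [set: option E] B u; exists P; first by exists u.
move=> v /Pv le EN _; exists (w None) => x wx w'x.
apply: (full_rank_mulmx_eq0
  (A := rowspan [set: option E] (fun o => map_mx (meval v) (B o)))).
  apply: leq_trans (eq_leq (esym EN)) _; rewrite addn1 -card_option -cardsT.
  apply: leq_trans rw _.
  apply: leq_trans le; apply: mxrankS; apply: rowspan_sub => o oT.
  have := sub_rowspan (fun o => map_mx (meval u) (B o)) oT; rewrite BE.
  by case: o {oT} => [e|//]; rewrite uw.
by apply: rowspan_mulmx_eq0 => -[e|] _; rewrite BE.
Qed.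

Lemma generic_unique_noncollapsed : (1 < N)%N -> exists2 P, nonvanishing P &
  forall v, meval v P != 0 ->
    (unique_noncollapsed A (edge_vector v) <-> (#|E| + 1 = N)%N /\ sparse A).
Proof.
move=> N1.
have /choice[P PE] : forall F, exists P, nonvanishing P /\
    forall v, meval v P != 0 -> hall F A ->
      (#|F| <= \rank (rowspan F (fun e => edge_vector v e *m A e)))%N.
  by move=> F; have [P] := generic_independent F; exists P.
have /choice[Q QE] : forall e, exists P, nonvanishing P /\
    forall v, meval v P != 0 -> (#|E| + 1 = N)%N -> sparse A ->
      exists w' : 'rV[K]_2, forall x : 'cV[K]_N,
        solution A (edge_vector v) x -> w' *m A e *m x = 0 -> x = 0.
  by move=> e; have [P'] := generic_rigid e; exists P'.
(* There are finitely many [F] and [e], so one polynomial covers all the generic conditions. *)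
exists (\prod_F P F * \prod_e Q e).
  by apply: nonvanishingM; apply: nonvanishing_prod => i;
    [have [] := PE i | have [] := QE i].
move=> v; rewrite mevalM !rmorph_prod mulf_eq0 negb_or.
case/andP=> /prodf_neq0 Pv /prodf_neq0 Qv.
split=> [uniq|[EN sp]]; last first.
  apply: sparse_unique_noncollapsed => // e.
  by have [_ /(_ v (Qv e isT))] := QE e; apply.
have [x [vx ndx _]] := uniq.
have sp : sparse A.
  apply: noncollapsed_sparse vx ndx => F hF.
  by have [_ /(_ v (Pv F isT))] := PE F; apply.
split=> //; apply/eqP; rewrite eqn_leq; apply/andP; split; last first.
  by apply: unique_noncollapsed_card uniq => i; rewrite pnatr_eq0.
(* The bound [#|E| + 1 <= N] is sparsity of the full edge set, or [1 < N] when there are no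
   edges. *)
have [E0|E0] := eqVneq #|E| 0%N; first by rewrite E0 ltnW.
rewrite addn1 -cardsT; apply: leq_trans (sp _ _) (rank_leq_col _).
by rewrite -card_gt0 cardsT lt0n.
Qed.
End GenericSystem.
End Generic.

(** * Rotations *)

Section Rotations.
Variable R : realType.
Implicit Types s t : R.

Lemma rotmxD s t : rot (s + t) = rot s *m rot t.
Proof.
apply/matrixP => i j; rewrite !mxE big_ord_recl big_ord1 !mxE cosD sinD.
by case: i j => -[|[|//]] ? [[|[|//]] ?] /=; ring.
Qed.

Lemma rotmx0 : rot (0 : R) = 1%:M.
Proof.
apply/matrixP => i j; rewrite !mxE cos0 sin0 oppr0.
by case: eqP => // _; case: ifP.
Qed.

Lemma rotmxX t n : rot t ^+ n = rot (t *+ n).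
Proof. by elim: n => [|n IH]; rewrite ?rotmx0 // exprS IH mulrS rotmxD. Qed.

Lemma trmx_rot t : (rot t)^T = rot (- t).
Proof.
apply/matrixP => i j; rewrite !mxE cosN sinN opprK eq_sym.
by case: i j => -[|[|//]] ? [[|[|//]] ?].
Qed.

Lemma rot_trmxK t : (rot t)^T *m rot t = 1%:M.
Proof. by rewrite trmx_rot -rotmxD addNr rotmx0. Qed.

Lemma rotmxC s t : rot s *m rot t = rot t *m rot s.
Proof. by rewrite -!rotmxD addrC. Qed.

(** [2 - 2 * cos t] is the determinant of [rot t - 1]; if it is nonzero, only the zero vector is
    fixed. *)
Lemma rot_fix t (v : 'cV[R]_2) : rot t *m v = v -> v != 0 -> cos t = 1.
Proof.
move=> tv v0; apply/eqP; rewrite -subr_eq0; apply: contraNT v0 => c1.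
have e0 := congr1 (fun M : 'cV_2 => M 0 0) tv.
have e1 := congr1 (fun M : 'cV_2 => M 1 0) tv.
rewrite mxE big_ord_recl big_ord1 !mxE /= in e0.
rewrite mxE big_ord_recl big_ord1 !mxE /= in e1.
have lift1 : lift ord0 ord0 = 1 :> 'I_2 by apply: val_inj.
rewrite lift1 in e0 e1.
have cs := cos2Dsin2 t.
have n0 : 2 - 2 * cos t != 0.
  by apply: contraNneq c1 => h; apply/eqP; lra.
have v00 : v 0 0 = 0.
  apply: (mulfI n0); rewrite mulr0; nra.
have v10 : v 1 0 = 0.
  apply: (mulfI n0); rewrite mulr0; nra.
apply/eqP/colP => i; rewrite mxE.
by case: i => -[|[|//]] p; [rewrite -[RHS]v00|rewrite -[RHS]v10];
  congr (v _ _); apply: val_inj.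
Qed.

Section CyclicRotations.
Variables (k : nat) (hk : (1 < k)%N).
Implicit Types g h : 'Z_k.

Let angle : R := 2%:R * pi / k%:R.

(** The representative of [g + h] is reduced modulo [k], which is harmless since the [k]-th power of
    the rotation is 1. *)
Lemma rotZD g h : rotZ R (g + h) = rotZ R g *m rotZ R h.
Proof.
have rotk : rot angle ^+ k = 1.
  rewrite rotmxX -mulr_natr divfK ?pnatr_eq0 -?lt0n 1?ltnW // mulrC mulr_natr.
  apply/matrixP => i j; rewrite !mxE cos2pi sin2pi oppr0.
  by case: eqP => // _; case: ifP.
rewrite /rotZ -/angle -[RHS]exprD /= [in RHS](divn_eq (g + h) k) exprD mulnC.
by rewrite exprM rotk expr1n mul1r {3}(Zp_cast hk).
Qed.

Lemma rotZ0 : rotZ R (0 : 'Z_k) = 1%:M.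
Proof. by []. Qed.

Lemma rotZ_rot g : exists t, rotZ R g = rot t.
Proof. by rewrite /rotZ rotmxX; eexists. Qed.

(** Nonzero points have trivial stabilizer: with [s = pi * g / k], half the rotation angle,
    [cos (2 s) = 1] forces [sin s = 0], while [0 < s < pi] if [g] is nonzero. *)
Lemma rotZ_fix g (v : 'cV[R]_2) : rotZ R g *m v = v -> v != 0 -> g = 0.
Proof.
rewrite /rotZ rotmxX => gv v0; have := rot_fix gv v0.
have gk : (g < k)%N by rewrite -[X in (_ < X)%N](Zp_cast hk).
have k0 : (k%:R : R) != 0 by rewrite pnatr_eq0 -lt0n ltnW.
have -> : 2%:R * pi / k%:R *+ g = (pi * (g%:R / k%:R)) *+ 2 :> R.
  by rewrite -[LHS]mulr_natr -[RHS]mulr_natr; field.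
rewrite cos_mulr2n => c2; apply/val_inj/eqP; rewrite /= -leqn0 leqNgt.
apply/negP => g0; set s := pi * _ in c2.
have : 0 < sin s.
  apply: sin_gt0_pi; rewrite mulr_gt0 ?pi_gt0 ?divr_gt0 ?ltr0n // ?(ltn_trans _ hk) //=.
  by rewrite gtr_pMr ?pi_gt0 // ltr_pdivrMr ?mul1r ?ltr_nat // ltr0n (ltn_trans _ hk).
have := cos2Dsin2 s; move: c2; clear => *; nra.
Qed.

End CyclicRotations.
End Rotations.

(** * Components and potentials *)

Section Components.
Variables (k : nat) (G : colored_graph k).
Implicit Types (F : {set edge G}) (C : {set vert G}) (u v : vert G).

Lemma adj_sym F : ssrbool.symmetric (adj F).
Proof. by move=> u v; apply/eq_existsb => e; rewrite orbC. Qed.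

Lemma adj_edge F e : e \in F -> adj F (src e) (tgt e).
Proof. by move=> eF; apply/existsP; exists e; rewrite eF !eqxx. Qed.

Lemma src_span F e : e \in F -> src e \in span_vert F.
Proof. by move=> eF; rewrite inE imset_f. Qed.

Lemma tgt_span F e : e \in F -> tgt e \in span_vert F.
Proof. by move=> eF; rewrite inE [X in _ || X]imset_f ?orbT. Qed.

Lemma components_partition F : partition (components F) (span_vert F).
Proof.
apply: equivalence_partitionP => u v w _ _ _; split; first exact: connect0.
by move=> uv; apply: same_connect uv _; apply: sym_connect_sym; apply: adj_sym.
Qed.

Section Component.
Variables (F : {set edge G}) (C : {set vert G}).
Hypothesis CF : C \in components F.

Lemma component_sub : C \subset span_vert F.
Proof.
by rewrite -(cover_partition (components_partition F)); apply: bigcup_sup.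
Qed.

Lemma component_connect u v :
  u \in C -> v \in span_vert F -> (v \in C) = connect (adj F) u v.
Proof.
move=> uC vF; have uF := subsetP component_sub u uC.
have /and3P[_ tI _] := components_partition F.
rewrite -(def_pblock tI CF uC) pblock_equivalence_partition // => a b c _ _ _.
split; first exact: connect0.
by move=> uv; apply: same_connect uv _; apply: sym_connect_sym; apply: adj_sym.
Qed.

Lemma component_neq0 : C != set0.
Proof.
have /and3P[_ _ n0] := components_partition F.
by apply: contraNneq n0 => <-.
Qed.

Lemma component_tgt e : e \in component_edges F C -> tgt e \in C.
Proof.
rewrite inE => /andP[eF eC]; rewrite (component_connect eC) ?tgt_span //.
exact/connect1/adj_edge.
Qed.

Lemma component_src e : e \in F -> tgt e \in C -> src e \in C.
Proof.
move=> eF eC; rewrite (component_connect eC) ?src_span //.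
by apply: connect1; rewrite adj_sym adj_edge.
Qed.

Lemma component_edges_neq0 : component_edges F C != set0.
Proof.
case/set0Pn: component_neq0 => v vC.
have := subsetP component_sub v vC; rewrite inE => /orP[]/imsetP[e eF ve];
  apply/set0Pn; exists e; rewrite inE eF /= -?ve //.
by apply: component_src => //; rewrite -ve.
Qed.

(** [P] travels along a path from [u]; it must pass edges both ways because [adj] ignores
    orientation. *)
Lemma component_ind (P : vert G -> Prop) u : u \in C -> P u ->
  (forall e, e \in component_edges F C -> P (src e) <-> P (tgt e)) ->
  forall v, v \in C -> P v.
Proof.
move=> uC Pu step v vC.
have := component_connect uC (subsetP component_sub v vC); rewrite vC.
move=> /esym/connectP[p pp ->]; elim: p u uC Pu pp => //= w p IH u uC Pu /andP[uw pp].
case/existsP: uw => e /andP[eF] /orP[]/andP[/eqP eu /eqP ev].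
  have eC : e \in component_edges F C by rewrite inE eF eu.
  by apply: IH => //; rewrite -ev; [apply: component_tgt | apply/(step e eC); rewrite eu].
have eC : e \in component_edges F C by rewrite inE eF component_src // ev.
apply: IH => //; rewrite -eu; first by move: eC; rewrite inE => /andP[].
by apply/(step e eC); rewrite ev.
Qed.

End Component.

Lemma sum_component_edges F :
  #|F| = (\sum_(C in components F) #|component_edges F C|)%N.
Proof.
rewrite -sum1_card.
pose block e := pblock (components F) (src e).
rewrite (partition_big block (mem (components F))) /=; last first.
  move=> e eF; apply: pblock_mem.
  by rewrite (cover_partition (components_partition F)) src_span.
apply: eq_bigr => C CF; rewrite -sum1_card; apply: eq_bigl => e.
rewrite inE; case eF: (e \in F) => //=.
have /and3P[_ tI _] := components_partition F.
apply/eqP/idP => [<-|eC]; last exact: def_pblock tI CF eC.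
by rewrite mem_pblock (cover_partition (components_partition F)) src_span.
Qed.

Lemma card_span_components F :
  #|span_vert F| = (\sum_(C in components F) #|C|)%N.
Proof. exact: card_partition (components_partition F). Qed.

Lemma card_components F : #|components F| = (num_trivial F + num_nontrivial F)%N.
Proof.
rewrite -(cardsID [set C | `[< trivial_rho (component_edges F C) >]] (components F)).
by congr (_ + _)%N; apply: eq_card => C; rewrite !inE // andbC.
Qed.

Lemma num_trivialE F :
  num_trivial F = (\sum_(C in components F) `[< trivial_rho (component_edges F C) >])%N.
Proof.
rewrite /num_trivial -sum1_card big_mkcond [RHS]big_mkcond /=.
by apply: eq_bigr => C _; rewrite inE; case: (C \in _) => //=; case: ifP.
Qed.

End Components.

(** * Potentials and cycles with trivial image *)

Section Potentials.
Variables (k : nat) (G : colored_graph k).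
Implicit Types (F : {set edge G}) (C : {set vert G}) (z : edge G -> int).

(** The sign is chosen so that placing each [v] at [rotZ R (h v) *m p] collapses every edge of
    [F]. *)
Definition potential F (h : vert G -> 'Z_k) :=
  forall e, e \in F -> h (src e) = color e + h (tgt e).

Lemma boundaryB z1 z2 v :
  boundary (fun e => z1 e - z2 e) v = boundary z1 v - boundary z2 v.
Proof. by rewrite /boundary !sumrB opprD addrACA -opprD. Qed.

(** Summation by parts: the coboundary of [h] against [z] is [h] against the boundary of [z]. *)
Lemma boundary_pair z (h : vert G -> 'Z_k) :
  \sum_e (h (tgt e) - h (src e)) *~ z e = \sum_v h v *~ boundary z v.
Proof.
under eq_bigr do rewrite mulrzBl.
under [RHS]eq_bigr do rewrite /boundary mulrzBr.
rewrite !sumrB; congr (_ - _).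
  rewrite (partition_big (@tgt G) xpredT) //=; apply: eq_bigr => v _.
  by rewrite mulrz_sumr; apply: eq_bigr => e /eqP ->.
rewrite (partition_big (@src G) xpredT) //=; apply: eq_bigr => v _.
by rewrite mulrz_sumr; apply: eq_bigr => e /eqP ->.
Qed.

Lemma potential_trivial F h : potential F h -> trivial_rho F.
Proof.
move=> hF z [zF bz]; apply/eqP; rewrite -oppr_eq0 -sumrN.
rewrite (eq_bigr (fun e => (h (tgt e) - h (src e)) *~ z e)).
  by rewrite boundary_pair big1 // => v _; rewrite bz mulr0z.
move=> e _; have [eF|eF] := boolP (e \in F); last by rewrite zF // !mulr0z oppr0.
by rewrite (hF e eF) opprD addrCA subrr addr0 mulNrz.
Qed.

Lemma walk_rcons (x y : vert G) (w : seq (edge G * bool)) (s : edge G * bool) :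
  walk x w y -> step_src s = y -> walk x (rcons w s) (step_tgt s).
Proof.
elim: w x => [|t w IH] x /=; first by move=> /eqP-> ->; rewrite !eqxx.
by case/andP=> -> /IH h /h.
Qed.

(** Take minus the color sum along a chosen walk from a root. For an edge [e], the walk to [src e]
    followed by [e] and the walk to [tgt e] differ by a cycle, on which [rho] vanishes. *)
Lemma trivial_potential F C : C \in components F ->
  trivial_rho (component_edges F C) ->
  exists h, potential (component_edges F C) h.
Proof.
move=> CF tr; case/set0Pn: (component_neq0 CF) => r rC.
pose good v (w : seq (edge G * bool)) :=
  walk r w v /\ all (fun s => s.1 \in component_edges F C) w.
have goodC v : v \in C -> exists w, good v w.
  apply: (component_ind CF (P := fun v => exists w, good v w) rC).
    by exists [::]; rewrite /good /= eqxx.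
  move=> e eC; split=> -[w [rw wC]].
    exists (rcons w (e, true)); split; last by rewrite all_rcons eC.
    exact: (walk_rcons (s := (e, true)) rw erefl).
  exists (rcons w (e, false)); split; last by rewrite all_rcons eC.
  exact: (walk_rcons (s := (e, false)) rw erefl).
have /choice[w gw] : forall v, exists w, v \in C -> good v w.
  move=> v; have [vC|vC] := boolP (v \in C); last by exists [::].
  by have [w gw] := goodC v vC; exists w.
exists (fun v => - rho (walk_chain (w v))) => e eC.
have [rw1 all1] : good (src e) (w (src e)).
  by apply: gw; move: eC; rewrite inE => /andP[].
have [rw2 all2] := gw _ (component_tgt CF eC).
set w1 := w (src e) in rw1 all1 *; set w2 := w (tgt e) in rw2 all2 *.
pose w3 := rcons w1 (e, true).
have rw3 : walk r w3 (tgt e) by apply: (walk_rcons (s := (e, true)) rw1 erefl).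
have all3 : all (fun s => s.1 \in component_edges F C) w3 by rewrite all_rcons eC.
have chain0 w' e' : all (fun s => s.1 \in component_edges F C) w' ->
    e' \notin component_edges F C -> walk_chain w' e' = 0.
  move=> /allP al ne; rewrite /walk_chain big_seq big1 // => s /al sC.
  by case: eqP => // ee; rewrite -ee sC in ne.
have : rho (fun e => walk_chain w3 e - walk_chain w2 e) = 0.
  apply: tr; split=> [e' ne|v]; first by rewrite !chain0 // subrr.
  by rewrite boundaryB (boundary_walk rw3) (boundary_walk rw2) subrr.
rewrite /rho; under eq_bigr do rewrite mulrzBr.
rewrite sumrB -/(rho (walk_chain w3)) -/(rho (walk_chain w2)).
have -> : rho (walk_chain w3) = rho (walk_chain w1) + color e.
  by rewrite !rho_walk /w3 -cats1 big_cat big_seq1.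
by move=> /eqP; rewrite subr_eq0 => /eqP <-; rewrite opprD addrCA subrr addr0.
Qed.

End Potentials.

(** * Ranks of the cone system *)

Section ConeSystem.
Variables (R : realType) (k : nat) (hk : (1 < k)%N) (G : colored_graph k).
Implicit Types (F : {set edge G}) (C : {set vert G}).

Local Notation N := #|{: vert G * 'I_2}|.

(** Projection of the configuration vector onto the point of the vertex [(v, 0)] of the lift. *)
Definition pos (v : vert G) : 'M[R]_(2, N) :=
  \matrix_(a, c) (c == enum_rank (v, a))%:R.

Lemma posE v (x : 'cV[R]_N) a b : (pos v *m x) a b = x (enum_rank (v, a)) 0.
Proof.
rewrite mxE (bigD1 (enum_rank (v, a))) //= !mxE eqxx mul1r ord1 big1 ?addr0 // => c.
by rewrite mxE => /negPf ->; rewrite mul0r.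
Qed.

Lemma pos_surj (p : vert G -> 'cV[R]_2) :
  exists x : 'cV[R]_N, forall v, pos v *m x = p v.
Proof.
exists (\col_c p (enum_val c).1 (enum_val c).2 0) => v.
by apply/matrixP => a b; rewrite posE mxE enum_rankK (ord1 b).
Qed.

Lemma pos_eq0 (x : 'cV[R]_N) : (forall v, pos v *m x = 0) -> x = 0.
Proof.
move=> x0; apply/colP => c; have := x0 (enum_val c).1.
move/(congr1 (fun M : 'cV_2 => M (enum_val c).2 0)); rewrite posE mxE.
by rewrite -surjective_pairing enum_valK mxE.
Qed.

(** The lifted edge [(e, 0)] ends at [(tgt e, color e)], whence the rotation. *)
Definition displacement (e : edge G) : 'M[R]_(2, N) :=
  rotZ R (color e) *m pos (tgt e) - pos (src e).

(* (perp d)^T *m D = d^T *m (quarter^T *m D): moving the quarter turn onto the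
   displacement makes the rows of the system linear in d itself. *)
Definition edge_plane (e : edge G) : 'M[R]_(2, N) :=
  (rot (pi / 2%:R))^T *m displacement e.

Lemma edge_plane_eq0 e (x : 'cV[R]_N) :
  edge_plane e *m x = 0 <-> pos (src e) *m x = rotZ R (color e) *m (pos (tgt e) *m x).
Proof.
rewrite /edge_plane -mulmxA; split=> [|h].
  move/(congr1 (mulmx (rot (pi / 2%:R)))); rewrite mulmxA trmx_rot -rotmxD subrr rotmx0.
  rewrite mul1mx mulmx0 mulmxBl -mulmxA => /eqP; rewrite subr_eq0 => /eqP ->.
  by [].
by rewrite mulmxBl -mulmxA -h subrr mulmx0.
Qed.

(** All rows lie in the span of [pos v] for [v] in [C]. In the trivial case a potential writes them
    through the blocks [D v], and [D r = 0] saves two dimensions. *)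
Lemma edge_plane_rank_upper F C : C \in components F ->
  (\rank (rowspan (component_edges F C) edge_plane) +
   2 * `[< trivial_rho (component_edges F C) >] <= 2 * #|C|)%N.
Proof.
move=> CF; case: asboolP => [tr|_]; last first.
  rewrite muln0 addn0; apply: leq_trans (mxrank_rowspan C pos).
  apply: mxrankS; apply: rowspan_sub => e eC.
  apply: submx_trans (submxMl _ _) _; apply: addmx_sub.
    by apply: submx_trans (submxMl _ _) _; apply/sub_rowspan/(component_tgt CF).
  by rewrite eqmx_opp; apply: sub_rowspan; move: eC; rewrite inE => /andP[].
have [h hC] := trivial_potential CF tr.
case/set0Pn: (component_neq0 CF) => r rC.
pose D v := pos v - rotZ R (h v - h r) *m pos r.
have Dr : D r = 0 by rewrite /D subrr rotZ0 mul1mx subrr.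
have subD v : v \in C -> (D v <= rowspan (C :\ r) D)%MS.
  move=> vC; have [->|vr] := eqVneq v r; first by rewrite Dr sub0mx.
  by apply: sub_rowspan; rewrite !inE vr.
rewrite (cardsD1 r) rC mulnDr addnC leq_add2l.
apply: leq_trans (mxrank_rowspan (C :\ r) D).
apply: mxrankS; apply: rowspan_sub => e eC.
apply: submx_trans (submxMl _ _) _.
(* The [pos r] terms cancel because [color e + (h (tgt e) - h r) = h (src e) - h r]. *)
have -> : displacement e = rotZ R (color e) *m D (tgt e) - D (src e).
  rewrite /displacement /D mulmxBr mulmxA -rotZD // addrA -(hC e eC).
  by rewrite opprB addrA subrK.
apply: addmx_sub.
  by apply: submx_trans (submxMl _ _) _; apply/subD/(component_tgt CF).
by rewrite eqmx_opp; apply: subD; move: eC; rewrite inE => /andP[].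
Qed.

(** Pinning to 0 the vertices outside the span and one vertex per trivial component leaves only the
    zero solution, so the rank is at least [N - 2 * #|T|]. *)
Lemma edge_plane_rank_lower F :
  (2 * #|span_vert F| <= \rank (rowspan F edge_plane) + 2 * num_trivial F)%N.
Proof.
have [v0 _] := card_gt0P (vert_gt0 G).
(* [v0] is a dummy value for sets that are not components. *)
have /choice[r rC] : forall C, exists v, C \in components F -> v \in C.
  move=> C; have [CF|_] := boolP (C \in components F); last by exists v0.
  by case/set0Pn: (component_neq0 CF) => v; exists v.
pose B := [set C in components F | `[< trivial_rho (component_edges F C) >]].
pose T := ~: span_vert F :|: r @: B.
have cT : (#|T| <= #|vert G| - #|span_vert F| + num_trivial F)%N.
  rewrite cardsU; apply: leq_trans (leq_subr _ _) _.
  by rewrite cardsCs setCK leq_add2l leq_imset_card.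
have full : \rank (rowspan F edge_plane + rowspan T pos)%MS = N.
  apply: full_rank_kernel => x kx; apply: pos_eq0 => v.
  have xF e : e \in F -> pos (src e) *m x = rotZ R (color e) *m (pos (tgt e) *m x).
    move=> eF; apply/edge_plane_eq0; apply: sub_mulmx_eq0 kx.
    by apply: submx_trans (addsmxSl _ _); apply: sub_rowspan.
  have xT u : u \in T -> pos u *m x = 0.
    move=> uT; apply: sub_mulmx_eq0 kx.
    by apply: submx_trans (addsmxSr _ _); apply: sub_rowspan.
  have [vF|vF] := boolP (v \in span_vert F); last first.
    by apply: xT; rewrite !inE -in_setU vF.
  have : v \in cover (components F) by rewrite (cover_partition (components_partition F)).
  case/bigcupP => C CF vC.
  (* The edge equations keep the points of a component in one orbit of the rotations. *)
  have orbit u w : u \in C -> w \in C ->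
      exists g : 'Z_k, pos w *m x = rotZ R g *m (pos u *m x).
    move=> uC wC.
    apply: (component_ind CF
      (P := fun w => exists g : 'Z_k, pos w *m x = rotZ R g *m (pos u *m x)) uC) wC.
      by exists 0; rewrite rotZ0 mul1mx.
    move=> e; rewrite inE => /andP[eF _]; split=> -[g gE].
      exists (g - color e).
      by rewrite addrC rotZD // -mulmxA -gE xF // mulmxA -rotZD // addNr rotZ0 mul1mx.
    by exists (color e + g); rewrite xF // gE rotZD // mulmxA.
  have [tr|ntr] := pselect (trivial_rho (component_edges F C)).
    have [g ->] := orbit _ _ (rC C CF) vC.
    rewrite xT ?mulmx0 // !inE; apply/orP; right; apply: imset_f.
    by rewrite inE CF; apply/asboolP.
  (* A nonzero point has trivial stabilizer, so the rotations carrying it to the other points of [C]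
     form a potential, against nontriviality. *)
  have [//|pv0] := eqVneq (pos v *m x) 0; case: ntr.
  have /choice[h hE] : forall w, exists g : 'Z_k,
      w \in C -> pos w *m x = rotZ R g *m (pos v *m x).
    move=> w; have [wC|_] := boolP (w \in C); last by exists 0.
    by have [g gE] := orbit v w vC wC; exists g.
  apply: (@potential_trivial _ _ _ h) => e eC.
  have tC := component_tgt CF eC; move: eC; rewrite inE => /andP[eF sC].
  set p := pos v *m x in pv0 hE *.
  have gE : rotZ R (h (src e)) *m p = rotZ R (color e + h (tgt e)) *m p.
    by rewrite -(hE _ sC) xF // (hE _ tC) mulmxA -rotZD.
  apply/eqP; rewrite -subr_eq0 addrC; apply/eqP; apply: (rotZ_fix hk _ pv0).
  by rewrite rotZD // -mulmxA gE mulmxA -rotZD // addNr rotZ0 mul1mx.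
have := mxrank_adds_leqif (rowspan F edge_plane) (rowspan T pos).
case=> + _; rewrite full => le.
have cN : N = (#|vert G| * 2)%N by rewrite card_prod card_ord.
have rT : (\rank (rowspan T pos) <= 2 * #|T|)%N := mxrank_rowspan T pos.
have nF : (#|span_vert F| <= #|vert G|)%N := max_card _.
by lia.
Qed.

(** The lower rank bound on all of [F] gives sparsity from the Laman count; the upper bound, applied
    to each component separately, gives the converse. *)
Lemma cone_laman_sparse :
  cone_laman G <-> (#|edge G| + 1 = N)%N /\ sparse edge_plane.
Proof.
rewrite /cone_laman; have V0 := vert_gt0 G.
have cN : N = (#|vert G| * 2)%N by rewrite card_prod card_ord.
split=> -[cE sp]; split; first by lia.
- move=> F F0; have := sp F (elimN eqP F0); have := edge_plane_rank_lower F.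
  (* At least one component exists, which makes the sparsity inequality strict. *)
  have : (0 < #|components F|)%N.
    rewrite card_gt0; case/set0Pn: F0 => e /src_span eF.
    apply/set0Pn; exists (pblock (components F) (src e)); apply: pblock_mem.
    by rewrite (cover_partition (components_partition F)).
  by rewrite card_components; lia.
- by lia.
move=> F /eqP F0.
suff : (#|F| + #|components F| + 2 * num_trivial F <= 2 * #|span_vert F|)%N.
  by rewrite card_components; lia.
(* All counts are sums over components, and sparsity of one component contributes the term 1. *)
rewrite sum_component_edges card_span_components num_trivialE -sum1_card.
rewrite !big_distrr /= -!big_split /=; apply: leq_sum => C CF.
have := sp _ (component_edges_neq0 CF); have := edge_plane_rank_upper CF.
by lia.
Qed.

End ConeSystem.

(** * Realizations *)

Local Notation lift := Defs.lift.

Section Realizations.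
Variables (R : realType) (k : nat) (hk : (1 < k)%N) (G : colored_graph k).
Implicit Types (d : directions R G).

Local Notation N := #|{: vert G * 'I_2}|.
Local Notation A := (@edge_plane R k G).

Definition lift_point (x : 'cV[R]_N) (v : vert (lift G)) : 'cV[R]_2 :=
  rotZ R v.2 *m (pos R v.1 *m x).

Lemma lift_point_diff (x : 'cV[R]_N) (e : edge G) (g : 'Z_k) :
  lift_point x (@tgt (lift G) (e, g)) - lift_point x (@src (lift G) (e, g)) =
  rotZ R g *m (displacement R e *m x).
Proof. by rewrite /lift_point /= rotZD // mulmxBl mulmxBr !mulmxA. Qed.

Lemma dotvE (u v : 'cV[R]_2) : dotv u v = (v^T *m u) 0 0.
Proof. by rewrite mxE; apply: eq_bigr => i _; rewrite mxE mulrC. Qed.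

(** Displacement and direction of the copy [(e, g)] are both rotated by [rotZ R g], which commutes
    with the quarter turn and preserves [dotv]; all copies of [e] impose one equation. *)
Lemma edge_equation d (x : 'cV[R]_N) (a : edge (lift G)) :
  dotv (lift_point x (tgt a) - lift_point x (src a)) (perp (lift_dir d a)) =
  ((d a.1)^T *m A a.1 *m x) 0 0.
Proof.
case: a => e g; rewrite lift_point_diff dotvE /perp /lift_dir /=.
have [t ->] := rotZ_rot R g.
rewrite !trmx_mul !mulmxA -[_ *m _^T *m rot t]mulmxA trmx_rot rotmxC.
by rewrite mulmxA -[_ *m _^T *m rot t]mulmxA rot_trmxK mulmx1 -!mulmxA.
Qed.

Lemma realization_lift_point d (x : 'cV[R]_N) :
  realization d (lift_point x) <-> solution A (fun e => (d e)^T) x.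
Proof.
split=> [[dx _] e|dx].
  by apply/matrixP => i j; rewrite (ord1 i) (ord1 j) -(edge_equation d x (e, 0)) dx mxE.
split=> [a|g v]; first by rewrite edge_equation dx mxE.
by rewrite /lift_point /= addrC rotZD // -mulmxA.
Qed.

(** Symmetry alone determines [p] from the copies labelled 0. *)
Lemma realization_lifted d p : realization d p -> exists x, p = lift_point x.
Proof.
case=> _ sym; have [x xE] := pos_surj (fun v => p (v, 0 : 'Z_k)).
exists x; apply/funext => -[v g]; rewrite /lift_point /= xE -sym.
by rewrite /lift_act /= add0r.
Qed.

Lemma faithful_lift_point (x : 'cV[R]_N) : faithful (lift_point x) <-> noncollapsed A x.
Proof.
have eqE (e : edge G) (g : 'Z_k) :
    lift_point x (@src (lift G) (e, g)) = lift_point x (@tgt (lift G) (e, g))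
      <-> A e *m x = 0.
  rewrite edge_plane_eq0 /lift_point /= rotZD // -[in X in _ = X <-> _]mulmxA.
  split=> [|->] //; move/(congr1 (mulmx (rotZ R (- g)))).
  have K (z : 'cV[R]_2) : rotZ R (- g) *m (rotZ R g *m z) = z.
    by rewrite mulmxA -rotZD // addNr rotZ0 mul1mx.
  by rewrite !K.
by split=> [fx e /(eqE e 0) /fx|nx [e g] /eqE /nx].
Qed.

Lemma lift_pointZ c (x : 'cV[R]_N) v : lift_point (c *: x) v = c *: lift_point x v.
Proof. by rewrite /lift_point -!scalemxAr. Qed.

Lemma unique_faithful_realizationE d :
  unique_faithful_realization d <-> unique_noncollapsed A (fun e => (d e)^T).
Proof.
split=> [[p [rp fp up]]|[x [sx nx ux]]].
  have [x px] := realization_lifted rp; rewrite {}px in rp fp up.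
  exists x; split; [exact/realization_lift_point | exact/faithful_lift_point|].
  move=> y /realization_lift_point sy /faithful_lift_point ny.
  have [c c0 yx] := up _ sy ny; exists c => //; apply/eqP; rewrite -subr_eq0.
  apply/eqP/pos_eq0 => v; rewrite mulmxBr; apply/eqP; rewrite subr_eq0; apply/eqP.
  by have := yx (v, 0); rewrite -lift_pointZ /lift_point /= rotZ0 !mul1mx.
exists (lift_point x); split; [exact/realization_lift_point | exact/faithful_lift_point|].
move=> q rq; have [y qy] := realization_lifted rq; rewrite {}qy in rq *.
move/faithful_lift_point => ny; have [|c c0 ->] := ux y _ ny.
  exact/realization_lift_point.
by exists c => // v; rewrite lift_pointZ.
Qed.

Lemma edge_vector_coords d e : edge_vector (coords d) e = (d e)^T.
Proof. by apply/rowP => j; rewrite !mxE /coords mxvecE mxE enum_rankK. Qed.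

Lemma coords_surj v : exists d, coords d =1 v.
Proof.
exists (fun e => (edge_vector v e)^T) => i; rewrite /coords.
by case/mxvec_indexP: i => a b; rewrite mxvecE !mxE enum_valK.
Qed.

End Realizations.

Theorem theorem3 (R : realType) (k : nat) (hk : (1 < k)%N)
    (G : colored_graph k) :
  exists Z : set (directions R G),
    proper_algebraic Z /\
    forall d : directions R G,
      ~ Z d -> (unique_faithful_realization d <-> cone_laman G).
Proof.
have N1 : (1 < #|{: vert G * 'I_2}|)%N.
  by rewrite card_prod card_ord; have := vert_gt0 G; lia.
have [P [v Pv] PE] := generic_unique_noncollapsed (@edge_plane R k G) N1.
(* The zero set of [P] is proper because the point [v] off it is the coordinate vector of some
   assignment. *)
exists (fun d => meval (coords d) P = 0); split; first split.
- exists (fun Q => Q = P); apply/seteqP; split=> d /=; first by move=> Pd Q ->.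
  exact.
- have [d dv] := coords_surj v.
  move=> /(congr1 (fun Z => Z d)) ZT; case/eqP: Pv.
  by rewrite -(meval_eq _ dv) ZT.
move=> d /eqP Pd.
have -> : unique_faithful_realization d <->
    unique_noncollapsed (@edge_plane R k G) (edge_vector (coords d)).
  have -> : edge_vector (coords d) = (fun e => (d e)^T).
    by apply/funext => e; apply: edge_vector_coords.
  exact: unique_faithful_realizationE.
apply: iff_trans (PE _ Pd) _; apply: iff_sym; exact: cone_laman_sparse.
Qed.
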